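(* Let $\lambda\in\mathbb{R}$. For every integer $n\ge 0$, \[ \mathrm{Bel}_{n+1,\lambda}= \sum_{m=0}^{n}\binom{n}{m}\mathrm{Bel}_{m,\lambda}\,(1)_{n-m+1,\lambda}. \]
   Context: For $\lambda\in\mathbb{R}$, $(x)_{0,\lambda}=1$ and $(x)_{n,\lambda}=x(x-\lambda)\cdots(x-(n-1)\lambda)$ for $n\ge1$. The degenerate exponential is $e_\lambda(t)=\sum_{k\ge0}(1)_{k,\lambda}t^k/k!$ (equal to $(1+\lambda t)^{1/\lambda}$ for $\lambda\ne0$, $e^t$ for $\lambda=0$). The degenerate Bell polynomials are defined by $e^{x(e_{\lambda}(t)-1)}=\sum_{n=0}^{\infty}\mathrm{Bel}_{n,\lambda}(x)\frac{t^{n}}{n!}$, and the degenerate Bell numbers are $\mathrm{Bel}_{n,\lambda}=\mathrm{Bel}_{n,\lambda}(1)$. *)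

(* Defs.v *)
(* Stdlib world: concrete reals, with Coquelicot's operations on the
   coefficient sequences of power series. *)
From Stdlib Require Import Reals Factorial.
From Coquelicot Require Import Coquelicot.
Open Scope R_scope.

(* (x)_{n,lam} = x (x - lam) ... (x - (n-1) lam). *)
Fixpoint degenerate_falling (lam x : R) (n : nat) : R :=
  match n with
  | O => 1
  | S m => degenerate_falling lam x m * (x - INR m * lam)
  end.

(* Generating functions are formal power series in t: a sequence [a : nat -> R]
   stands for the series whose coefficient of t^n is [a n]. Sum, difference,
   scaling and Cauchy product are Coquelicot's [PS_plus], [PS_minus],
   [PS_scal] and [PS_mult]. *)

Definition PS_one : nat -> R :=
  fun n => match n with O => 1 | S _ => 0 end.

Fixpoint PS_pow (a : nat -> R) (k : nat) : nat -> R :=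
  match k with
  | O => PS_one
  | S j => PS_mult a (PS_pow a j)
  end.

(* e^a = sum_k a^k / k!, taken coefficient by coefficient. When [a 0 = 0], the
   only case used below, [PS_pow a k n = 0] for k > n, so every coefficient is
   a finite sum. *)
Definition PS_exp (a : nat -> R) : nat -> R :=
  fun n => Series (fun k => PS_pow a k n / INR (fact k)).

(* e_lam(t) = sum_k (1)_{k,lam} t^k / k!. *)
Definition degenerate_exp (lam : R) : nat -> R :=
  fun k => degenerate_falling lam 1 k / INR (fact k).

(* n! times the coefficient of t^n in e^{x (e_lam(t) - 1)}, i.e. the solution of
   e^{x (e_lam(t) - 1)} = sum_n Bel_{n,lam}(x) t^n / n!. *)
Definition degenerate_bell_poly (lam : R) (n : nat) (x : R) : R :=
  INR (fact n) * PS_exp (PS_scal x (PS_minus (degenerate_exp lam) PS_one)) n.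

Definition degenerate_bell (lam : R) (n : nat) : R :=
  degenerate_bell_poly lam n 1.

(* Main.v *)
(* Formally differentiating [e^a] gives [(e^a)' = e^a a'].  For
   [a = e_lam(t) - 1] the coefficients of [a'] are [(1)_{j+1,lam} / j!], so
   comparing the coefficients of [t^n] is the claimed recurrence. *)
Require Import Defs.
From Stdlib Require Import Reals Factorial Lia.
From Coquelicot Require Import Coquelicot.
Open Scope R_scope.

(** Peeling off the constant term of the left factor makes identities between Cauchy products
    provable by induction on the degree, with that factor generalised. *)
Lemma PS_mult_S (a b : nat -> R) (n : nat) :
  PS_mult a b (S n) = a O * b (S n) + PS_mult (PS_decr_1 a) b n.
Proof.
  unfold PS_mult, PS_decr_1. rewrite decomp_sum by lia.
  simpl pred. rewrite Nat.sub_0_r. reflexivity.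
Qed.

Lemma PS_mult_comm (a b : nat -> R) (n : nat) :
  PS_mult a b n = PS_mult b a n.
Proof.
  revert a. induction n as [|n IH]; intros a.
  - unfold PS_mult; simpl; ring.
  (* The peeled term [a O * b (S n)] is the last term of the swapped product. *)
  - rewrite PS_mult_S, IH. unfold PS_mult. rewrite tech5, Nat.sub_diag.
    rewrite Rplus_comm. f_equal; [|ring].
    apply sum_eq. intros k Hk. rewrite Nat.sub_succ_l by lia. reflexivity.
Qed.

(** Agreement is asked only up to degree [n] because a truncated exponential matches [PS_exp] only
    in low degrees. *)
Lemma PS_mult_ext_le (a a' b b' : nat -> R) (n : nat) :
  (forall k, (k <= n)%nat -> a k = a' k) ->
  (forall k, (k <= n)%nat -> b k = b' k) ->
  PS_mult a b n = PS_mult a' b' n.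
Proof.
  intros Ha Hb. apply sum_eq. intros k Hk.
  rewrite Ha, Hb by lia. reflexivity.
Qed.

(** The combination has the shape that [PS_mult_S] gives to [PS_decr_1 (PS_mult a b)]. *)
Lemma PS_mult_scal_plus_l (x : R) (a a' b : nat -> R) (n : nat) :
  PS_mult (fun k => x * a k + a' k) b n = x * PS_mult a b n + PS_mult a' b n.
Proof.
  unfold PS_mult. rewrite scal_sum, <- plus_sum.
  apply sum_eq. intros k _. ring.
Qed.

Lemma PS_mult_assoc (a b c : nat -> R) (n : nat) :
  PS_mult (PS_mult a b) c n = PS_mult a (PS_mult b c) n.
Proof.
  revert a. induction n as [|n IH]; intros a.
  - unfold PS_mult; simpl; ring.
  - rewrite (PS_mult_S (PS_mult a b)), (PS_mult_S a), (PS_mult_S b), <- IH.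
    rewrite (PS_mult_ext_le (PS_decr_1 (PS_mult a b))
      (fun k => a O * PS_decr_1 b k + PS_mult (PS_decr_1 a) b k) c c n).
    + rewrite PS_mult_scal_plus_l. unfold PS_mult at 1. simpl. ring.
    + intros k _. apply PS_mult_S.
    + reflexivity.
Qed.

Lemma PS_derive_mult (a b : nat -> R) (n : nat) :
  PS_derive (PS_mult a b) n =
  PS_mult (PS_derive a) b n + PS_mult a (PS_derive b) n.
Proof.
  unfold PS_derive at 1, PS_mult at 1. rewrite scal_sum.
  (* Leibniz rule: the weight [S n] splits as [k + (S n - k)]. The first half then loses its term at
     [k = 0], the second its term at [k = S n]. *)
  rewrite (sum_eq _ (fun k => INR k * a k * b (S n - k)%nat
                     + a k * (INR (S n - k) * b (S n - k)%nat))).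
  2:{ intros k Hk. rewrite minus_INR by lia. ring. }
  rewrite plus_sum. f_equal.
  - rewrite decomp_sum by lia. simpl pred.
    change (INR 0) with 0. rewrite !Rmult_0_l, Rplus_0_l. reflexivity.
  - rewrite tech5, Nat.sub_diag. change (INR 0) with 0.
    rewrite Rmult_0_l, Rmult_0_r, Rplus_0_r.
    apply sum_eq. intros k Hk. unfold PS_derive.
    rewrite Nat.sub_succ_l by lia. reflexivity.
Qed.

Lemma PS_derive_pow (a : nat -> R) (k n : nat) :
  PS_derive (PS_pow a (S k)) n =
  INR (S k) * PS_mult (PS_pow a k) (PS_derive a) n.
Proof.
  revert n. induction k as [|k IH]; intros n.
  - change (PS_pow a 1) with (PS_mult a (PS_pow a 0)).
    rewrite PS_derive_mult, (PS_mult_comm (PS_derive a)).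
    replace (PS_mult a (PS_derive (PS_pow a 0)) n) with 0; [simpl; ring|].
    symmetry. apply sum_eq_R0. intros j _. unfold PS_derive. simpl. ring.
  - change (PS_pow a (S (S k))) with (PS_mult a (PS_pow a (S k))).
    rewrite PS_derive_mult, (PS_mult_comm (PS_derive a)).
    replace (PS_mult a (PS_derive (PS_pow a (S k))) n)
      with (INR (S k) * PS_mult (PS_pow a (S k)) (PS_derive a) n);
      [rewrite (S_INR (S k)); ring|].
    (* Regrouping as [a] times [PS_mult (PS_pow a k) (PS_derive a)] lets the induction hypothesis
       apply to each coefficient of the right factor. *)
    change (PS_pow a (S k)) with (PS_mult a (PS_pow a k)) at 1.
    rewrite PS_mult_assoc.
    unfold PS_mult at 1. rewrite scal_sum.
    apply sum_eq. intros j _. rewrite IH. ring.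
Qed.

(** Each factor [a] raises the order by at least one, since [a O = 0] kills the only term where the
    remaining power keeps its full degree. *)
Lemma PS_pow_lt (a : nat -> R) (k n : nat) :
  a O = 0 -> (n < k)%nat -> PS_pow a k n = 0.
Proof.
  intros Ha. revert n. induction k as [|k IH]; intros n Hn; [lia|].
  apply sum_eq_R0. intros [|j] Hj.
  - rewrite Ha. ring.
  - rewrite IH by lia. ring.
Qed.

(** The partial sums are constant from [N] on. Leaving [N] free allows one truncation to serve all
    degrees up to [n]. *)
Lemma PS_exp_finite (a : nat -> R) (n N : nat) :
  a O = 0 -> (n <= N)%nat ->
  PS_exp a n = sum_f_R0 (fun k => PS_pow a k n / INR (fact k)) N.
Proof.
  intros Ha HN. apply is_series_unique.
  apply filterlim_ext_loc with
    (f := fun _ => sum_f_R0 (fun k => PS_pow a k n / INR (fact k)) N);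
    [| apply filterlim_const].
  exists N. intros M HM. rewrite sum_n_Reals.
  induction HM as [|M HM IH]; [reflexivity|].
  rewrite tech5, <- IH, PS_pow_lt by (assumption || lia).
  unfold Rdiv. ring.
Qed.

Lemma PS_mult_sum_l (f : nat -> nat -> R) (b : nat -> R) (n N : nat) :
  PS_mult (fun m => sum_f_R0 (fun k => f k m) N) b n =
  sum_f_R0 (fun k => PS_mult (f k) b n) N.
Proof.
  induction N as [|N IH]; [reflexivity|].
  rewrite tech5, <- IH. unfold PS_mult. rewrite <- plus_sum.
  apply sum_eq. intros m _. rewrite tech5. ring.
Qed.

Lemma PS_derive_exp (a : nat -> R) (n : nat) :
  a O = 0 ->
  PS_derive (PS_exp a) n = PS_mult (PS_exp a) (PS_derive a) n.
Proof.
  intros Ha.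
  rewrite (PS_mult_ext_le (PS_exp a)
    (fun m => sum_f_R0 (fun k => PS_pow a k m / INR (fact k)) n)
    (PS_derive a) (PS_derive a)) by
    (reflexivity || intros; apply PS_exp_finite; assumption).
  rewrite PS_mult_sum_l.
  (* The left side is truncated one step later: its term at [k = 0] is a constant series and
     vanishes in degree [S n], and the term at [S k] is matched with the term at [k] on the
     right. *)
  unfold PS_derive at 1. rewrite (PS_exp_finite a (S n) (S n)) by auto.
  rewrite decomp_sum by lia. simpl pred.
  simpl (PS_pow a 0 (S n)). unfold Rdiv at 1.
  rewrite Rmult_0_l, Rplus_0_l, scal_sum.
  apply sum_eq. intros k _.
  pose proof (PS_derive_pow a k n) as E. unfold PS_derive at 1 in E.
  rewrite fact_simpl, mult_INR.
  replace (PS_pow a (S k) (S n) / (INR (S k) * INR (fact k)) * INR (S n))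
    with (INR (S n) * PS_pow a (S k) (S n) / (INR (S k) * INR (fact k)))
    by (unfold Rdiv; ring).
  rewrite E.
  transitivity (/ INR (fact k) * PS_mult (PS_pow a k) (PS_derive a) n).
  - field. split; [apply INR_fact_neq_0 | apply not_0_INR; lia].
  - unfold PS_mult. rewrite scal_sum. apply sum_eq. intros; unfold Rdiv; ring.
Qed.

Theorem theorem2 (lam : R) (n : nat) :
  degenerate_bell lam (n + 1) =
  sum_f_R0 (fun m : nat =>
    Binomial.C n m * degenerate_bell lam m
      * degenerate_falling lam 1 (n - m + 1)) n.
Proof.
  unfold degenerate_bell, degenerate_bell_poly.
  set (a := PS_scal 1 (PS_minus (degenerate_exp lam) PS_one)).
  assert (Ha : forall j, a j = degenerate_exp lam j - PS_one j).
  { intros j. unfold a, PS_scal, PS_minus, PS_plus, PS_opp, scal, plus, opp.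
    simpl. unfold mult; simpl. ring. }
  assert (Ha0 : a O = 0).
  { rewrite Ha. unfold degenerate_exp. simpl. field. }
  rewrite Nat.add_1_r, fact_simpl, mult_INR.
  (* The factor [S n] of [(S n)!] turns the coefficient of degree [S n] into that of degree [n] of
     the derivative. *)
  transitivity (INR (fact n) * PS_derive (PS_exp a) n).
  { unfold PS_derive. ring. }
  rewrite PS_derive_exp by exact Ha0.
  unfold PS_mult. rewrite scal_sum. apply sum_eq. intros m Hm.
  (* The index [S (n - m)] is positive, so [PS_one] contributes 0; the factor from differentiation
     reduces [(S (n - m))!] to the [(n - m)!] of the binomial. *)
  unfold PS_derive, Binomial.C. rewrite Nat.add_1_r, Ha.
  unfold degenerate_exp. rewrite fact_simpl, mult_INR. simpl PS_one.
  field. repeat split; try apply INR_fact_neq_0. apply not_0_INR; lia.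
Qed.
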